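(* Let $r\geq 2$. Then there exists a constant $c_r$ such that for every $n$, the number of $r$-uniform hypergraphs on a fixed set of $n$ vertices having girth at least $5$ is at most $2^{c_r n^{3/2}}$.
   Context: Hypergraphs are simple (no repeated edges). $C_2$ denotes the graph consisting of two parallel edges between two vertices, and $C_k$ ($k\ge 3$) the cycle of length $k$. For a graph $F$, a hypergraph $H$ is a Berge-$F$ if there is a bijection $f : E(F) \to E(H)$ with $e \subseteq f(e)$ for every $e \in E(F)$. An $r$-uniform hypergraph has girth at least $5$ if it contains no subhypergraph that is a Berge-$C_k$ for any $k\in\{2,3,4\}$ (in particular any two edges share at most one vertex). *)

(* Defs.v *)
From mathcomp Require Import all_boot.
From Stdlib Require Import Reals.

Set Implicit Arguments.
Unset Strict Implicit.
Unset Printing Implicit Defensive.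

Definition hypergraph (n : nat) := {set {set 'I_n}}.

Definition uniform (n r : nat) (H : hypergraph n) : bool :=
  [forall e in H, #|e| == r].

Definition cyc_succ (k : nat) (i : 'I_k) : nat := (i.+1 %% k)%N.

(* H contains a Berge-C_k (k >= 2) as a subhypergraph: there are k distinct
   vertices v_0..v_{k-1} (the vertices of the cycle C_k, for k = 2 the two
   vertices of two parallel edges) and k distinct edges e_0..e_{k-1} of H
   (the bijective image of the edges of C_k) with {v_i, v_{i+1 mod k}} ⊆ e_i. *)
Definition has_Berge_cycle (n : nat) (H : hypergraph n) (k : nat) : bool :=
  [exists v : {ffun 'I_k -> 'I_n}, exists e : {ffun 'I_k -> {set 'I_n}},
    [&& injectiveb v, injectiveb e &
      [forall i : 'I_k,
        [&& e i \in H, v i \in e i &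
          [forall j : 'I_k, (nat_of_ord j == cyc_succ i) ==> (v j \in e i)]]]]].

Definition girth_ge5 (n : nat) (H : hypergraph n) : bool :=
  ~~ [|| has_Berge_cycle H 2, has_Berge_cycle H 3 | has_Berge_cycle H 4].

(* Main.v *)
(* In an r-uniform hypergraph of girth at least 5 every r-clique of the shadow
   graph is a hyperedge, since otherwise two hyperedges share two vertices or
   three form a Berge triangle. The hypergraph is thus determined by the r^2
   graphs joining the i-th and the j-th vertex of each hyperedge, and these
   graphs contain no C4. It remains to bound the number of C4-free graphs on n
   vertices by 2^(O(n^(3/2))), which is the Kleitman-Winston theorem: remove
   vertices of minimum degree one at a time, and show that a C4-free graph of
   minimum degree d has only 2^(O(sqrt n)) extensions by a vertex of degree at
   most d + 1. The new neighbourhood is an independent set in the square of the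
   graph, and large vertex sets are dense in that square by convexity, so that
   independent sets lie in few containers of size O(n / d). *)
Require Import Defs.
From mathcomp Require Import all_boot zify.

Set Implicit Arguments.
Unset Strict Implicit.
Unset Printing Implicit Defensive.

(** * Elementary inequalities between powers *)

Lemma expn_pred_Bernoulli z m : z ^ m * (z - m) <= z.-1 ^ m * z.
Proof.
elim: m => [|m IHm]; first by rewrite !expn0 subn0.
case: z IHm => [|z] IHm; first by rewrite sub0n muln0.
have [le_zm|lt_mz] := leqP z m; first by rewrite subSS (eqP le_zm) muln0.
have step : z.+1 * (z.+1 - m.+1) <= z * (z.+1 - m) by nia.
rewrite !expnS -!mulnA [z.+1 * _]mulnCA.
apply: leq_trans (leq_mul (leqnn _) step) _.
by rewrite mulnCA leq_mul2l IHm orbT.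
Qed.

Lemma expnS_le_double y m : m.*2 <= y.+1 -> y.+1 ^ m <= 2 * y ^ m.
Proof.
move=> le_my; have /= := expn_pred_Bernoulli y.+1 m.
nia.
Qed.

(** This is [(1 - 1/D)^D <= 1/2]: the first two terms of the binomial expansion of [((D - 1) + 1)^D]
    already add up to at least [2 (D - 1)^D]. *)
Lemma double_expn_pred D : 0 < D -> 2 * D.-1 ^ D <= D ^ D.
Proof.
case: D => [|D] //=.
have := expnDn D 1 D.+1.
rewrite addn1 => ->; rewrite 2!big_ord_recl /= !exp1n !muln1.
rewrite bin0 bin1 mul1n subn0 /bump /= subSS subn0 mulSn expnS.
nia.
Qed.

(** [L ^ k] is at most a falling factorial of [L + k], which is [k!] times a binomial coefficient,
    itself at most [2 ^ (L + k)]. *)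
Lemma expn_le_exp2 k : exists C, forall L, L ^ k <= C * 2 ^ L.
Proof.
exists (k`! * 2 ^ k) => L.
have le_ffact : L ^ k <= (L + k) ^_ k.
  elim: k => [|k IHk]; first by [].
  rewrite expnS addnS ffactnS /= leq_mul //; lia.
rewrite (leq_trans le_ffact) // -bin_ffact mulnC -mulnA -expnD [k + L]addnC.
rewrite leq_mul2l; apply/orP; right.
rewrite -[2]/(1 + 1) expnDn.
have lt_k : k < (L + k).+1 by rewrite ltnS leq_addl.
by rewrite (bigD1 (Ordinal lt_k)) //= !exp1n !muln1 leq_addr.
Qed.

(** * Counting independent sets by containers *)

Lemma card_small_subsets (T : finType) (S : {set T}) d :
  #|[set I : {set T} | I \subset S & #|I| <= d]| = \sum_(j < d.+1) 'C(#|S|, j).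
Proof.
rewrite -sum1_card (partition_big (fun I : {set T} => inord #|I| : 'I_d.+1) predT) //=.
apply: eq_bigr => j _; rewrite -(cards_draws S j) -sum1_card.
apply: eq_bigl => I; rewrite !inE -andbA.
congr (_ && _); have [le_Id|] := leqP #|I| d => /=.
  by rewrite -[LHS](inj_eq val_inj) /= inordK.
by case: eqP => // ->; rewrite ltnNge -ltnS ltn_ord.
Qed.

(** Chernoff-style weighting: a set of size [j <= d] gets the weight [y ^ (d - j) >= 1], so the
    truncated binomial sum is at most [y ^ d (1 + 1/y) ^ R]. *)
Lemma card_small_subsets_weighted (T : finType) (S : {set T}) d y R :
  0 < y -> #|S| <= R ->
  #|[set I : {set T} | I \subset S & #|I| <= d]| * y ^ R <= y ^ d * y.+1 ^ R.
Proof.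
move=> y0 leSR; rewrite card_small_subsets big_distrl /=.
have := expnDn y 1 R; rewrite addn1 => ->; rewrite big_distrr /=.
apply: (@leq_trans (\sum_(j < d.+1 | j < R.+1) y ^ d * ('C(R, j) * (y ^ (R - j) * 1 ^ j)))).
  rewrite big_mkcond [leqRHS]big_mkcond /=; apply: leq_sum => j _.
  have [le_jR|lt_Rj] := ltnP j R.+1; last by rewrite bin_small ?mul0n //; lia.
  rewrite exp1n muln1 mulnCA -expnD leq_mul ?leq_bin2l //.
  by rewrite leq_pexp2l //; have := ltn_ord j; lia.
rewrite -(big_mkord (fun j => j < R.+1)
  (fun j => y ^ d * ('C(R, j) * (y ^ (R - j) * 1 ^ j)))).
rewrite -(big_mkord predT (fun j => y ^ d * ('C(R, j) * (y ^ (R - j) * 1 ^ j)))).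
rewrite (big_nat_widen 0 d.+1 (d + R).+1) ?ltnS ?leq_addr //.
rewrite (big_nat_widen 0 R.+1 (d + R).+1) ?ltnS ?leq_addl //.
rewrite big_mkcond [leqRHS]big_mkcond /=; apply: leq_sum => j _.
by case: (j < R.+1); case: (j < d.+1).
Qed.

Section Containers.
Variables (T : finType) (adj : rel T).

Definition independent (I : {set T}) := [forall x in I, forall z in I, ~~ adj x z].

Definition small_independent d (S : {set T}) :=
  [set I : {set T} | [&& I \subset S, #|I| <= d & independent I]].

Definition neighbours_in (S : {set T}) v := [set x in S | adj v x].

Lemma independentS (I J : {set T}) : I \subset J -> independent J -> independent I.
Proof.
move=> /subsetP sIJ /forall_inP indJ; apply/forall_inP => x /sIJ xJ.
by apply/forall_inP => z /sIJ zJ; move/forall_inP: (indJ x xJ) => /(_ z zJ).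
Qed.

(** Branches on whether [v] lies in the independent set; if so, removing it is injective and leaves
    a set that avoids the neighbours of [v]. *)
Lemma small_independent_step d (S : {set T}) v :
  #|small_independent d S| <= #|small_independent d (S :\ v)|
     + #|small_independent d ((S :\ v) :\: neighbours_in S v)|.
Proof.
rewrite -(cardsID [set I : {set T} | v \in I]) addnC leq_add //.
  apply: subset_leq_card; apply/subsetP => I; rewrite !inE.
  move=> /andP[vI /and3P[sIS -> ->]]; rewrite !andbT.
  by rewrite subsetD1 sIS vI.
rewrite -(@card_in_imset _ _ (fun I : {set T} => I :\ v)).
  apply: subset_leq_card; apply/subsetP => _ /imsetP[I + ->].
  rewrite !inE => /andP[/and3P[sIS leId indI] vI].
  rewrite (leq_trans _ leId) ?subset_leq_card ?subD1set //.
  rewrite (independentS _ indI) ?subD1set // !andbT.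
  apply/subsetP => x; rewrite !inE => /andP[-> xI] /=.
  rewrite (subsetP sIS) //= andbT.
  by move/forall_inP: indI => /(_ v vI)/forall_inP/(_ x xI).
move=> I J; rewrite !inE => /andP[_ vI] /andP[_ vJ] eqIJ.
by rewrite -(setD1K vI) eqIJ setD1K.
Qed.

(* Each dense step multiplies the size of the ambient set by at most
   [1 - 1/D], so [q] steps bring it below [R]; each costs a factor [#|V|.+1]. *)
Lemma container_bound d D R M :
  0 < D ->
  (forall S : {set T}, #|S| <= R -> #|small_independent d S| <= M) ->
  forall V : {set T},
  (forall S : {set T}, S \subset V -> R < #|S| ->
     exists2 v, v \in S & (~~ adj v v) && (#|S| <= D * #|neighbours_in S v|)) ->
  forall q, D.-1 ^ q * #|V| <= D ^ q * R ->
  #|small_independent d V| <= #|V|.+1 ^ q * M.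
Proof.
move=> D0 base V; move: {2}#|V|.+1 (ltnSn #|V|) => k.
elim: k V => // k IHk V ltVk dense q leq_q.
have [leVR|ltRV] := leqP #|V| R.
  by rewrite (leq_trans (base V leVR)) // leq_pmull // expn_gt0.
case: q leq_q => [|q] leq_q; first by move: leq_q; rewrite !expn0 !mul1n; lia.
have [v vV /andP[nvv degv]] := dense V (subxx V) ltRV.
have cardV1 : #|V| = #|V :\ v|.+1 by rewrite (cardsD1 v) vV.
set W := (V :\ v) :\: neighbours_in V v.
have sWV : W \subset V by rewrite (subset_trans (subsetDl _ _)) ?subD1set.
have cardW : #|W| + #|neighbours_in V v| < #|V|.
  rewrite cardV1 ltnS -(cardsID (neighbours_in V v) (V :\ v)) addnC leq_add2r.
  rewrite subset_leq_card //; apply/subsetP => x; rewrite !inE.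
  case/andP=> xV vx; rewrite xV vx !andbT.
  by apply: contraNneq nvv => xv; rewrite xv in vx.
have denseS (U : {set T}) : U \subset V -> forall S : {set T}, S \subset U -> R < #|S| ->
     exists2 v, v \in S & (~~ adj v v) && (#|S| <= D * #|neighbours_in S v|).
  by move=> sUV S sSU; apply: dense; apply: subset_trans sUV.
apply: leq_trans (small_independent_step d V v) _.
(* Omitting [v] removes one vertex and keeps the budget [q.+1]; taking it spends one step. The two
   factors add up to at most [#|V|.+1 ^ q.+1]. *)
have b1 : #|small_independent d (V :\ v)| <= #|V| ^ q.+1 * M.
  rewrite {1}cardV1; apply: IHk; first by lia.
    exact/denseS/subD1set.
  by apply: leq_trans leq_q; rewrite leq_mul // cardV1.
have b2 : #|small_independent d W| <= #|W|.+1 ^ q * M.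
  apply: IHk; first by lia.
    exact: denseS.
  have le_DW : D * #|W| <= D.-1 * #|V|.
    by move: cardW degv; case: (D) D0 => // D' _ /=; nia.
  rewrite -(leq_pmul2l D0) [leqRHS]mulnA -expnS.
  apply: leq_trans leq_q; rewrite expnSr mulnCA -mulnA.
  by rewrite leq_mul2l le_DW orbT.
apply: leq_trans (leq_add b1 b2) _; rewrite -mulnDl leq_mul // !expnS.
have leq_expl a b : a <= b -> a ^ q <= b ^ q.
  by case: (q) => // p; rewrite leq_exp2r.
by rewrite mulSn addnC leq_add ?leq_mul ?leq_expl //; lia.
Qed.

End Containers.

(** * C4-free graphs *)

Section C4Free.
Variable T : finType.
Implicit Types (N : {ffun T -> {set T}}) (A I S : {set T}) (u v w x : T).

(** A graph is given by its neighbourhood function; a C4 amounts to two distinct vertices with two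
    common neighbours. *)
Definition C4_free N :=
  [&& [forall x, x \notin N x], [forall x, forall y, (y \in N x) == (x \in N y)]
    & [forall x, forall y, (x != y) ==> (#|N x :&: N y| <= 1)]].

Lemma C4_freeP N :
  reflect [/\ forall x, x \notin N x, forall x y, (y \in N x) = (x \in N y)
            & forall x y, x != y -> #|N x :&: N y| <= 1] (C4_free N).
Proof.
apply: (iffP and3P) => -[irr sym codeg]; split.
- exact/forallP.
- by move=> x y; apply/eqP; move/forallP: sym => /(_ x)/forallP.
- by move=> x y; move/forallP: codeg => /(_ x)/forallP/(_ y)/implyP.
- exact/forallP.
- by apply/'forall_forallP => x y; rewrite sym.
- by apply/'forall_forallP => x y; apply/implyP/codeg.
Qed.

Definition square_adj N u x := (u != x) && (0 < #|N u :&: N x|).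

(** Double counting of the paths [u w x] with distinct ends in [S]: each centre [w] carries
    [c * c.-1] of them, and without C4 each pair of ends has at most one centre. *)
Lemma sum_codegree N S : C4_free N ->
  \sum_(u in S) #|neighbours_in (square_adj N) S u|
    >= \sum_w #|N w :&: S| * #|N w :&: S|.-1.
Proof.
move=> /C4_freeP[irr sym codeg].
have cardI (B C : {set T}) : #|B :&: C| = \sum_w (w \in B) * (w \in C).
  rewrite -sum1_card big_mkcond; apply: eq_bigr => w _.
  by rewrite inE; case: (w \in B); case: (w \in C).
apply: (@leq_trans (\sum_(u in S) \sum_(x in S | u != x) #|N u :&: N x|)); last first.
  apply: leq_sum => u uS.
  rewrite -sum1_card [leqRHS](eq_bigl (fun x => (x \in S) && square_adj N u x)) => [|x]; last first.
    by rewrite !inE.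
  rewrite big_mkcond [leqRHS]big_mkcond; apply: leq_sum => x _.
  rewrite /square_adj; case: (x \in S) => //=; case: eqVneq => //= ux.
  by have := codeg u x ux; case: (#|_|) => [|[]].
have -> : \sum_(u in S) \sum_(x in S | u != x) #|N u :&: N x| =
  \sum_w \sum_(u in S) \sum_(x in S | u != x) (u \in N w) * (x \in N w).
  rewrite [RHS]exchange_big; apply: eq_bigr => u _.
  rewrite [RHS]exchange_big; apply: eq_bigr => x _.
  by rewrite cardI; apply: eq_bigr => w _; rewrite !(sym w).
apply: leq_sum => w _.
rewrite -sum_nat_const.
rewrite [leqLHS](eq_bigl (fun u => (u \in S) && (u \in N w))) => [|u]; last first.
  by rewrite inE andbC.
rewrite big_mkcondr; apply: leq_sum => u uS.
case: ifP => // uNw.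
rewrite (cardsD1 u) inE uNw uS /= -sum1_card.
rewrite [leqLHS](eq_bigl (fun x => (x \in S) && (u != x) && (x \in N w))) => [|x]; last first.
  by rewrite !inE eq_sym [X in _ && X]andbC andbCA andbA.
rewrite big_mkcondr; apply: leq_sum => x _.
by case: (x \in N w).
Qed.

Lemma sum_degrees_in N A S delta : C4_free N -> S \subset A ->
  {in A, forall u, delta <= #|N u|} -> #|S| * delta <= \sum_w #|N w :&: S|.
Proof.
move=> /C4_freeP[irr sym codeg] /subsetP sSA mindeg.
have -> : \sum_w #|N w :&: S| = \sum_(u in S) #|N u|.
  rewrite (eq_bigr (fun w => \sum_(u in S) (w \in N u))) => [|w _]; last first.
    rewrite -sum1_card [LHS]big_mkcond [RHS]big_mkcond; apply: eq_bigr => u _.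
    by rewrite inE (sym w); case: (_ \in S); case: (_ \in N _).
  rewrite exchange_big; apply: eq_bigr => u _.
  by rewrite -sum1_card [RHS]big_mkcond; apply: eq_bigr => w _; case: (_ \in N _).
by rewrite -sum_nat_const; apply: leq_sum => u /sSA; apply: mindeg.
Qed.

(** If every vertex of [S] had too few neighbours in the square, then [D * m < #|S| * #|S|] for
    their total [m]; convexity of the path count gives the opposite inequality. *)
Lemma square_dense N A S delta D : C4_free N -> S \subset A ->
  {in A, forall u, delta <= #|N u|} -> 0 < #|S| ->
  2 * #|T| <= #|S| * delta -> 8 * #|T| <= D * (delta * delta) ->
  exists2 v, v \in S &
    (~~ square_adj N v v) && (#|S| <= D * #|neighbours_in (square_adj N) S v|).
Proof.
move=> C4N sSA mindeg S0 leS leD.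
suff /exists_inP[v vS degv] :
    [exists v in S, #|S| <= D * #|neighbours_in (square_adj N) S v|].
  by exists v => //; rewrite degv /square_adj eqxx.
apply: contraT; rewrite negb_exists => /forallP sparse.
have T0 : 0 < #|T| by rewrite (leq_trans S0) ?max_card.
have lt_sum : D * (\sum_(u in S) #|neighbours_in (square_adj N) S u|) < #|S| * #|S|.
  rewrite big_distrr /=.
  apply: (@leq_ltn_trans (\sum_(u in S) #|S|.-1)).
    apply: leq_sum => u uS; have := sparse u; rewrite uS /= -ltnNge.
    by move: S0; case: (#|S|).
  by rewrite sum_nat_const ltn_mul2l S0 ltn_predL.
have ge_t := sum_degrees_in C4N sSA mindeg.
set t := \sum_w _ in ge_t.
have ge_sum := sum_codegree S C4N.
set m := \sum_(u in S) _ in lt_sum ge_sum.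
(* About half the lower bound [#|S| * delta / #|T|] on the average of [#|N w :&: S|]; halving keeps
   the error [#|T| * (k * k)] below half of [k * t]. *)
set k := (#|S| * delta) %/ (2 * #|T|).
have k0 : 0 < k by rewrite divn_gt0 // muln_gt0.
(* The tangent bound [k * c <= c * c.-1 + k * k] plays the role of Cauchy-Schwarz. *)
have tangent : k * t <= m + #|T| * (k * k).
  apply: leq_trans (leq_add ge_sum (leqnn _)).
  rewrite -sum_nat_const -big_split big_distrr /=; apply: leq_sum => w _.
  by set c := #|_|; have [le_ck|] := leqP c k; nia.
have kT : k * (2 * #|T|) <= #|S| * delta by exact: leq_trunc_div.
(* Since [k >= 1], rounding down loses at most a factor of two. *)
have kT2 : #|S| * delta <= k * (4 * #|T|).
  have := ltn_ceil (#|S| * delta) (_ : 0 < 2 * #|T|); rewrite -/k muln_gt0 /= => /(_ T0).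
  nia.
have two_m : k * (#|S| * delta) <= 2 * m.
  have : k * (k * (2 * #|T|)) <= k * t by rewrite leq_mul // (leq_trans kT).
  have : k * (#|S| * delta) <= k * t by rewrite leq_mul.
  lia.
have sq : (#|S| * delta) * (#|S| * delta) <= 8 * #|T| * m.
  apply: leq_trans (leq_mul kT2 (leqnn _)) _.
  have := leq_mul (leqnn (4 * #|T|)) two_m.
  lia.
have fin : 8 * #|T| * (#|S| * #|S|) <= 8 * #|T| * (D * m).
  have := leq_mul leD (leqnn (#|S| * #|S|)).
  have := leq_mul (leqnn D) sq.
  lia.
by move: fin; rewrite leq_pmul2l ?muln_gt0 // leqNgt lt_sum.
Qed.

End C4Free.

(** [L ^ 8] is at most a constant times [2 ^ L], which is [O(s ^ 2)]. This absorbs the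
    polylogarithmic cost of the containers into [s]. *)
Lemma log_power_le_sqrt : exists C, forall n s L,
  2 ^ L <= 2 * n -> n < s.+1 ^ 2 -> 0 < s -> L ^ 4 <= C * s.
Proof.
have [C HC] := expn_le_exp2 8.
exists (8 * C) => n s L leL ltn s0.
rewrite -leq_sqr -expnM; apply: leq_trans (HC L) _.
have : 2 ^ L <= 8 * (s * s) by move: ltn; rewrite -mulnn; nia.
move=> /(leq_mul (leqnn C))/leq_trans; apply; rewrite -mulnn.
by case: C {HC} => // C; nia.
Qed.

(** * Extending a C4-free graph by one vertex *)

Section Extensions.
Variable T : finType.
Implicit Types (N : {ffun T -> {set T}}) (A I S : {set T}).

(** The candidate neighbourhoods of a new vertex: the last condition forbids a C4 through it. *)
Definition extensions N A d :=
  [set I : {set T} | [&& I \subset A, #|I| <= d & [forall w, #|N w :&: I| <= 1]]].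

Lemma extensions_independent N A d : C4_free N ->
  extensions N A d \subset small_independent (square_adj N) d A.
Proof.
move=> /C4_freeP[_ sym _]; apply/subsetP => I; rewrite !inE.
move=> /and3P[-> -> /forallP codeg] /=.
apply/forall_inP => u uI; apply/forall_inP => x xI; rewrite negb_and negbK.
case: (eqVneq u x) => //= ux; rewrite -leqNgt leqn0 cards_eq0.
apply/eqP/setP => w; rewrite !inE; apply/negP => /andP[wu wx].
have := codeg w; rewrite leqNgt => /card_gt1P[]; exists u, x.
by rewrite !inE !(sym w) wu wx.
Qed.

(** For [d] at most [s / L] it suffices to count all sets of size at most [d.+1], with the weight
    [y = 2 * n]. *)
Lemma card_extensions_small N A d n L s : #|T| = n -> 0 < n -> n < 2 ^ L -> d * L <= s ->
  #|extensions N A d.+1| <= 2 ^ (1 + 2 * (s + L)).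
Proof.
move=> cardT n0 ltnL ledL.
have L0 : 0 < L by case: L ltnL {ledL} => //; lia.
have := @card_small_subsets_weighted T A d.+1 (2 * n) n _ _.
rewrite muln_gt0 n0 -cardT max_card => /(_ isT isT); rewrite cardT => weighted.
have dbl : (2 * n).+1 ^ n <= 2 * (2 * n) ^ n by apply: expnS_le_double; lia.
have pow0 : 0 < (2 * n) ^ n by rewrite expn_gt0 muln_gt0 n0.
have le1 : #|[set I : {set T} | I \subset A & #|I| <= d.+1]| <= 2 * (2 * n) ^ d.+1.
  rewrite -(leq_pmul2r pow0) (leq_trans weighted) //.
  by rewrite [leqRHS]mulnAC [leqRHS]mulnC leq_mul2l dbl orbT.
apply: leq_trans (leq_trans le1 _).
  apply: subset_leq_card; apply/subsetP => I; rewrite !inE.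
  by case/and3P=> -> ->.
rewrite expnD expn1 leq_mul2l /=.
apply: (@leq_trans ((2 ^ L.+1) ^ d.+1)).
  by rewrite leq_exp2r // expnS leq_mul // ltnW.
by rewrite -expnM leq_exp2l //; nia.
Qed.

(** For larger [d], the [D * L] dense steps cost at most [2 ^ (8 * L ^ 4)], and each container of
    size at most [R] holds at most [2 ^ (10 * s)] candidates. *)
Lemma card_extensions_large N A d n L s : C4_free N ->
  {in A, forall u, d <= #|N u|} ->
  #|T| = n -> 0 < s -> n < s.+1 ^ 2 -> n < 2 ^ L -> s < d * L ->
  #|extensions N A d.+1| <= 2 ^ (8 * L ^ 4 + 10 * s).
Proof.
move=> C4N mindeg cardT s0 ltns ltnL ltsd.
have [d0 L0] : 0 < d /\ 0 < L by move: ltsd; case: (d); case: (L) => //; lia.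
(* [1 / y], of order [d / sqrt n], is the weight of a vertex in the union bound
   over the sets contained in a container of size at most [R]. *)
pose y := (s %/ d).+1; pose m := y.+1./2; pose R := 8 * s * m; pose D := 8 * L ^ 2.
have D0 : 0 < D by rewrite muln_gt0 expn_gt0 L0.
have m0 : 0 < m by rewrite half_gt0.
have le_ym : y <= m.*2 by rewrite /m; lia.
have R0 : 0 < R by rewrite !muln_gt0 s0 m0.
have ltsyd : s < y * d by exact: ltn_ceil.
have leRd : 2 * n <= R * d.
  have : n <= 2 * (s * s.+1) by move: ltns; rewrite -mulnn; nia.
  have : s * s.+1 <= s * (m.*2 * d).
    by rewrite leq_mul2l (leq_trans ltsyd) ?leq_mul ?orbT.
  by rewrite /R -muln2; lia.
apply: leq_trans (subset_leq_card (extensions_independent A d.+1 C4N)) _.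
apply: (@leq_trans (#|A|.+1 ^ (D * L) * 2 ^ (10 * s))).
  apply: (container_bound (D := D) (R := R)) => //.
  - move=> S leSR.
    apply: (@leq_trans #|[set I : {set T} | I \subset S & #|I| <= d.+1]|).
      apply: subset_leq_card; apply/subsetP => I; rewrite !inE.
      by case/and3P=> -> ->.
    have yR0 : 0 < y ^ R by rewrite expn_gt0.
    rewrite -(leq_pmul2r yR0).
    apply: leq_trans (card_small_subsets_weighted _ _ leSR) _ => //.
    (* [y ^ d.+1] is at most [2 ^ (2 * s)], and the [8 * s] blocks of length [m] in [R] each cost a
       factor 2. *)
    have -> : 10 * s = 2 * s + 8 * s by lia.
    rewrite expnD -mulnA leq_mul //.
      apply: (@leq_trans ((2 ^ (s %/ d)) ^ d.+1)).
        by rewrite leq_exp2r // /y ltn_expl.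
      rewrite -expnM leq_exp2l // mulnS.
      by have := leq_trunc_div s d; have := leq_div s d; lia.
    rewrite /R [8 * s * m]mulnC !(expnM _ m) -expnMn leq_exp2r ?muln_gt0 ?s0 //.
    by apply: expnS_le_double; rewrite /m; lia.
  - move=> S sSA ltRS; apply: (square_dense (delta := d) C4N sSA mindeg).
    + exact: leq_ltn_trans ltRS.
    + by rewrite cardT (leq_trans leRd) // leq_mul // ltnW.
    + rewrite cardT /D -mulnA leq_mul2l /=.
      have : s.+1 ^ 2 <= (d * L) ^ 2 by rewrite leq_sqr.
      by move: ltns; rewrite -!mulnn; nia.
  (* Every [D] steps halve the ambient set, so [L] rounds bring fewer than [2 ^ L] vertices down to
     one. *)
  - apply: (@leq_trans (D ^ (D * L) * 1)); last by rewrite leq_mul.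
    rewrite muln1 !(expnM _ D).
    apply: (@leq_trans ((D.-1 ^ D) ^ L * 2 ^ L)).
      by rewrite leq_mul // (leq_trans (max_card _)) // cardT ltnW.
    by rewrite -expnMn leq_exp2r // mulnC double_expn_pred.
rewrite expnD leq_mul //.
apply: (@leq_trans ((2 ^ L) ^ (D * L))).
  rewrite leq_exp2r; last exact: (leq_mul D0 L0).
  by apply: leq_trans ltnL; rewrite ltnS -cardT max_card.
by rewrite -expnM leq_exp2l // /D (expnD L 2 2) -!mulnn; lia.
Qed.

End Extensions.

Lemma card_extensions : exists C, forall (T : finType) (N : {ffun T -> {set T}})
    (A : {set T}) d s,
  C4_free N -> {in A, forall u, d <= #|N u|} ->
  0 < s -> s ^ 2 <= #|T| < s.+1 ^ 2 ->
  #|T| * #|extensions N A d.+1| <= 2 ^ (C * s).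
Proof.
have [C HC] := log_power_le_sqrt.
exists (11 * C + 13) => T N A d s C4N mindeg s0 /andP[les lts].
have T0 : 0 < #|T| by rewrite (leq_trans _ les) ?expn_gt0 ?s0.
have /andP[leL ltL] := trunc_log_bounds (isT : 1 < 2) T0.
set L := (trunc_log 2 #|T|).+1 in ltL.
have leL2 : 2 ^ L <= 2 * #|T| by rewrite expnS leq_mul2l leL.
have leL4 := HC _ _ _ leL2 lts s0.
have leL1 : L <= L ^ 4 by rewrite -[leqLHS]expn1 leq_pexp2l.
apply: (@leq_trans (2 ^ L * 2 ^ (8 * L ^ 4 + 13 * s + 2 * L))).
  apply: leq_mul; first exact: ltnW.
  have [ledL|ltdL] := leqP (d * L) s.
    apply: leq_trans (card_extensions_small N A (erefl _) T0 ltL ledL) _.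
    by rewrite leq_exp2l //; lia.
  apply: leq_trans (card_extensions_large C4N mindeg (erefl _) s0 lts ltL ltdL) _.
  by rewrite leq_exp2l //; lia.
by rewrite -expnD leq_exp2l //; nia.
Qed.

(** * Counting C4-free graphs by deleting vertices *)

Section Counting.
Variable T : finType.
Implicit Types (N : {ffun T -> {set T}}) (A I S : {set T}).

Definition C4_free_on A :=
  [set N : {ffun T -> {set T}} | C4_free N & [forall x, N x \subset A]].

(** The vertex type stays fixed: [v] becomes isolated, and [C4_free_on] records the remaining vertex
    set. *)
Definition delete_vertex v N : {ffun T -> {set T}} :=
  [ffun x => if x == v then set0 else N x :\ v].

Lemma delete_vertex_C4_free_on A N v :
  N \in C4_free_on A -> delete_vertex v N \in C4_free_on (A :\ v).
Proof.
rewrite !inE => /andP[/C4_freeP[irr sym codeg] /forallP sNA]; apply/andP; split.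
  apply/C4_freeP; split=> [x|x y|x y xy]; rewrite !ffunE.
  - by case: ifP => _; rewrite ?inE // (negbTE (irr x)) andbF.
  - have [->|xv] := eqVneq x v; have [->|yv] := eqVneq y v; rewrite !inE ?eqxx //.
    by rewrite xv yv sym.
  - apply: leq_trans (codeg x y xy); apply: subset_leq_card.
    by apply: setISS; case: ifP; rewrite ?sub0set ?subD1set.
apply/forallP => x; rewrite ffunE; case: ifP; rewrite ?sub0set // => _.
exact: setSD.
Qed.

Lemma delete_vertex_inj v N N' : C4_free N -> C4_free N' ->
  delete_vertex v N = delete_vertex v N' -> N v = N' v -> N = N'.
Proof.
move=> /C4_freeP[_ sym _] /C4_freeP[_ sym' _] eqdel eqv.
apply/ffunP => x; have [->//|xv] := eqVneq x v.
apply/setP => y; have [->|yv] := eqVneq y v; first by rewrite sym sym' eqv.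
move/ffunP/(_ x)/setP/(_ y): eqdel.
by rewrite !ffunE (negbTE xv) !inE yv.
Qed.

Definition min_degree_at A v :=
  [set N in C4_free_on A | [forall u in A, #|N v| <= #|N u|]].

(** A graph in a fibre of the deletion is determined by the neighbourhood of [v], which is an
    extension of the reduced graph. *)
Lemma card_min_degree_at A v B : v \in A ->
  (forall N' (A' : {set T}) d, C4_free N' -> {in A', forall u, d <= #|N' u|} ->
     #|T| * #|extensions N' A' d.+1| <= B) ->
  #|T| * #|min_degree_at A v| <= #|C4_free_on (A :\ v)| * B.
Proof.
move=> vA extB.
have -> : #|min_degree_at A v| = \sum_(N' in C4_free_on (A :\ v))
    #|[set N in min_degree_at A v | delete_vertex v N == N']|.
  rewrite -sum1_card (partition_big (delete_vertex v) [in C4_free_on (A :\ v)]) /=.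
    by apply: eq_bigr => N' _; rewrite -sum1_card; apply: eq_bigl => N; rewrite !inE.
  by move=> N; rewrite inE => /andP[/delete_vertex_C4_free_on].
rewrite big_distrr -sum_nat_const /=; apply: leq_sum => N' N'on.
set F := [set N in _ | _].
have [N0 N0F|F0] := pickP [in F]; last by rewrite (eq_card0 F0) muln0.
(* The neighbourhood of [v] is at most one larger than the minimum degree left
   after deleting [v], so [d] can be read off the largest one in the fibre. *)
case: (arg_maxnP (fun N : {ffun T -> {set T}} => #|N v|) N0F) => Nmax NmaxF maxN.
have N'free : C4_free N' by move: N'on; rewrite inE => /andP[].
apply: leq_trans (extB N' (A :\ v) #|Nmax v|.-1 N'free _).
  rewrite leq_mul2l; apply/orP; right.
  rewrite -(@card_in_imset _ _ (fun N : {ffun T -> {set T}} => N v)); last first.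
    move=> N1 N2; rewrite !inE => /andP[/andP[/andP[free1 _] _] /eqP del1].
    move=> /andP[/andP[/andP[free2 _] _] /eqP del2].
    by apply: delete_vertex_inj => //; rewrite del1.
  apply: subset_leq_card; apply/subsetP => _ /imsetP[N NF ->].
  have := maxN N NF; move: NF; rewrite !inE.
  move=> /andP[/andP[/andP[/C4_freeP[irr sym codeg] /forallP sNA] _] /eqP <-] leN.
  rewrite subsetD1 sNA irr (leq_trans leN) ?leqSpred //=.
  apply/forallP => w; rewrite ffunE; case: eqVneq => [_|wv].
    by rewrite set0I cards0.
  apply: leq_trans (codeg w v wv); apply: subset_leq_card.
  by apply: setSI; apply: subD1set.
move=> u; rewrite !inE => /andP[uv uA].
move: (NmaxF : Nmax \in F); rewrite !inE => /andP[/andP[_ /forall_inP mindeg] /eqP <-].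
rewrite ffunE (negbTE uv) -subn1 leq_subLR (leq_trans (mindeg u uA)) //.
by rewrite (cardsD1 v) leq_add2r leq_b1.
Qed.

(** For nonempty [A] every graph lies in some [min_degree_at A v]; the factor [#|T|] in the
    hypothesis pays for the choice of [v]. *)
Lemma card_C4_free_on A B :
  (forall N' (A' : {set T}) d, C4_free N' -> {in A', forall u, d <= #|N' u|} ->
     #|T| * #|extensions N' A' d.+1| <= B) ->
  #|C4_free_on A| <= B ^ #|A|.
Proof.
move=> extB; move cardA: #|A| => k.
elim: k A cardA => [|k IHk] A cardA.
  rewrite expn0; apply/card_le1_eqP => N N'.
  rewrite (cards0_eq cardA) !inE => /andP[_ /forallP sN] /andP[_ /forallP sN'].
  apply/ffunP => x; move: (sN x) (sN' x).
  by rewrite !subset0 => /eqP-> /eqP->.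
have [v0 v0A] : exists v, v \in A by apply/set0Pn; rewrite -cards_eq0 cardA.
have cover : #|C4_free_on A| <= \sum_(v in A) #|min_degree_at A v|.
  have -> : \sum_(v in A) #|min_degree_at A v| =
      \sum_(N in C4_free_on A) \sum_(v in A) (N \in min_degree_at A v).
    rewrite exchange_big; apply: eq_bigr => v _.
    rewrite -sum1_card big_mkcond [RHS]big_mkcond; apply: eq_bigr => N _.
    by rewrite [N \in min_degree_at A v]inE; do 2!case: ifP.
  rewrite -sum1_card; apply: leq_sum => N Non.
  case: (arg_minnP (fun v => #|N v|) v0A) => v vA minv.
  rewrite (bigD1 v) //= (_ : N \in _) // inE Non.
  exact/forall_inP.
have T0 : 0 < #|T| by apply/card_gt0P; exists v0.
rewrite -(leq_pmul2l T0); apply: leq_trans (leq_mul (leqnn _) cover) _.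
rewrite big_distrr /=.
apply: (@leq_trans (\sum_(v in A) B ^ k.+1)); last first.
  by rewrite sum_nat_const leq_mul // max_card.
apply: leq_sum => v vA; apply: leq_trans (card_min_degree_at vA extB) _.
have cardA1 : #|A :\ v| = k by move: cardA; rewrite (cardsD1 v) vA => -[].
by rewrite expnSr leq_mul // IHk.
Qed.

End Counting.

(** * From hypergraphs to graphs *)

Section BergeCycles.
Variables (n : nat) (H : hypergraph n).
Implicit Types (x y z w : 'I_n) (e f g h : {set 'I_n}).

Lemma Berge_cycle_seq k (v : k.-tuple 'I_n) (E : k.-tuple {set 'I_n}) x0 :
  uniq v -> uniq E -> all [in H] E ->
  (forall i, i < k -> (nth x0 v i \in nth set0 E i) &&
                      (nth x0 v (i.+1 %% k) \in nth set0 E i)) ->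
  has_Berge_cycle H k.
Proof.
move=> uv uE HE inc.
apply/existsP; exists [ffun i => tnth v i].
apply/existsP; exists [ffun i => tnth E i].
apply/and3P; split.
- by apply/injectiveP => i j; rewrite !ffunE; apply: (tuple_uniqP v uv).
- by apply/injectiveP => i j; rewrite !ffunE; apply: (tuple_uniqP E uE).
- apply/forallP => i; rewrite !ffunE.
  have /andP[vi vSi] := inc i (ltn_ord i).
  rewrite (allP HE) ?mem_tnth //= (tnth_nth set0) (tnth_nth x0) vi /=.
  apply/forallP => j; apply/implyP => /eqP ij.
  by rewrite ffunE (tnth_nth x0) ij.
Qed.

Lemma Berge_C2 x y e f : x != y -> e != f -> e \in H -> f \in H ->
  x \in e -> y \in e -> x \in f -> y \in f -> has_Berge_cycle H 2.
Proof.
move=> xy ef eH fH xe ye xf yf.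
apply: (@Berge_cycle_seq 2 [tuple x; y] [tuple e; f] x).
- by rewrite /= inE xy.
- by rewrite /= inE ef.
- by rewrite /= eH fH.
- by case=> [|[|//]] _; rewrite /= ?xe ?ye ?xf ?yf.
Qed.

Lemma Berge_C3 x y z e f g : uniq [:: x; y; z] -> uniq [:: e; f; g] ->
  e \in H -> f \in H -> g \in H ->
  x \in e -> y \in e -> y \in f -> z \in f -> z \in g -> x \in g ->
  has_Berge_cycle H 3.
Proof.
move=> uv uE eH fH gH xe ye yf zf zg xg.
apply: (@Berge_cycle_seq 3 [tuple x; y; z] [tuple e; f; g] x) => //.
- by rewrite /= eH fH gH.
- by case=> [|[|[|//]]] _; rewrite /= ?xe ?ye ?yf ?zf ?zg ?xg.
Qed.

Lemma Berge_C4 x y z w e f g h : uniq [:: x; y; z; w] -> uniq [:: e; f; g; h] ->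
  e \in H -> f \in H -> g \in H -> h \in H ->
  x \in e -> y \in e -> y \in f -> z \in f ->
  z \in g -> w \in g -> w \in h -> x \in h ->
  has_Berge_cycle H 4.
Proof.
move=> uv uE eH fH gH hH xe ye yf zf zg wg wh xh.
apply: (@Berge_cycle_seq 4 [tuple x; y; z; w] [tuple e; f; g; h] x) => //.
- by rewrite /= eH fH gH hH.
- by case=> [|[|[|[|//]]]] _; rewrite /= ?xe ?ye ?yf ?zf ?zg ?wg ?wh ?xh.
Qed.

End BergeCycles.

(** Take [e] through two vertices of [K]. A vertex of [K] outside [e] is joined to both by
    hyperedges other than [e]: if these coincide, they form a Berge-C2 with [e], otherwise a Berge
    triangle. *)
Lemma shadow_clique n r (H : hypergraph n) (K : {set 'I_n}) :
  2 <= r -> uniform r H -> girth_ge5 H -> #|K| = r ->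
  {in K &, forall x y, x != y -> exists2 e, e \in H & (x \in e) && (y \in e)} ->
  K \in H.
Proof.
move=> r2 /forall_inP unifH; rewrite /girth_ge5 !negb_or => /and3P[nC2 nC3 _].
move=> cardK clique.
have /card_gt1P[x [y [xK yK xy]]] : 1 < #|K| by rewrite cardK.
have [e eH /andP[xe ye]] := clique x y xK yK xy.
suff sKe : K \subset e.
  have /eqP-> : K == e by rewrite eqEcard sKe cardK (eqP (unifH e eH)) /=.
  exact: eH.
apply/subsetP => z zK; apply: contraNT nC3 => ze.
have xz : x != z by apply: contraNneq ze => <-.
have yz : y != z by apply: contraNneq ze => <-.
have [f fH /andP[yf zf]] := clique y z yK zK yz.
have [g gH /andP[xg zg]] := clique x z xK zK xz.
have ef : e != f by apply: contraNneq ze => ->.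
have eg : e != g by apply: contraNneq ze => ->.
have fg : f != g.
  apply: contraNneq nC2 => fg; rewrite -fg in xg.
  exact: (Berge_C2 xy ef eH fH).
apply: (@Berge_C3 _ _ x y z e f g) => //=.
- by rewrite !inE negb_or xy xz yz.
- by rewrite !inE negb_or ef eg fg.
Qed.

Lemma card_C4_free_setT : exists C, forall (T : finType) s,
  s ^ 2 <= #|T| < s.+1 ^ 2 -> #|C4_free_on [set: T]| <= 2 ^ (C * (s * #|T|)).
Proof.
have [C HC] := card_extensions; exists C => T s ns.
rewrite mulnA expnM -[in leqRHS]cardsT; apply: card_C4_free_on => N A d C4N mindeg.
(* The case [s = 0] forces [T] to be empty. *)
have [s0|] := posnP s; last by move=> s0; apply: HC.
have -> : #|T| = 0 by move: ns; rewrite s0; case: (#|T|).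
by rewrite mul0n.
Qed.

(** * Link graphs of a hypergraph *)

Section Links.
Variables (n : nat) (i j : nat).
Implicit Types (H : hypergraph n) (e : {set 'I_n}) (x y z w : 'I_n).

Definition rank_in e x := index x (enum e).

Definition linked e x y := [&& x \in e, y \in e &
  ((rank_in e x == i) && (rank_in e y == j)) ||
  ((rank_in e x == j) && (rank_in e y == i))].

(* Every hyperedge contributes at most one edge, joining its [i]-th and its
   [j]-th vertex, so a C4 here lifts to four distinct hyperedges. *)
Definition link_graph H : {ffun 'I_n -> {set 'I_n}} :=
  [ffun x => [set y | (x != y) && [exists e in H, linked e x y]]].

Lemma linkedC e x y : linked e x y = linked e y x.
Proof.
rewrite /linked andbCA; do 2!congr (_ && _).
by rewrite orbC; congr (_ || _); rewrite andbC.
Qed.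

Lemma rank_in_inj e : {in e &, injective (rank_in e)}.
Proof.
move=> x y; rewrite -[x \in e]mem_enum -[y \in e]mem_enum.
exact: index_inj.
Qed.

(** For fixed [i] and [j] a hyperedge links only one pair, so a linked vertex outside [x] and [y]
    needs another hyperedge. *)
Lemma linked_distinct e f x y z w : linked e x y -> linked f z w ->
  z != x -> z != y -> e != f.
Proof.
move=> exy fzw zx zy; apply: contraTneq fzw => <-; apply/negP => ezw.
move: exy ezw; rewrite /linked => /and3P[xe ye +] /and3P[ze _].
move=> /orP[] /andP[/eqP xi /eqP yj] /orP[] /andP[/eqP zi _].
- by move: zx; rewrite (rank_in_inj ze xe (etrans zi (esym xi))) eqxx.
- by move: zy; rewrite (rank_in_inj ze ye (etrans zi (esym yj))) eqxx.
- by move: zy; rewrite (rank_in_inj ze ye (etrans zi (esym yj))) eqxx.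
- by move: zx; rewrite (rank_in_inj ze xe (etrans zi (esym xi))) eqxx.
Qed.

Lemma link_graph_C4_free H : girth_ge5 H -> C4_free (link_graph H).
Proof.
rewrite /girth_ge5 !negb_or => /and3P[_ _ nC4].
apply/C4_freeP; split=> [x|x y|x y xy]; rewrite !ffunE.
- by rewrite inE eqxx.
- by rewrite !inE eq_sym; under eq_existsb do rewrite linkedC.
rewrite leqNgt; apply: contra nC4 => /card_gt1P[w [z []]].
rewrite !inE => /andP[/andP[xw /exists_inP[e eH exw]] /andP[yw /exists_inP[f fH fyw]]].
move=> /andP[/andP[xz /exists_inP[h hH hxz]] /andP[yz /exists_inP[g gH gyz]]] wz.
have [/and3P[xe we _] /and3P[yf wf _]] := conj exw fyw.
have [/and3P[xh zh _] /and3P[yg zg _]] := conj hxz gyz.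
apply: (@Berge_C4 _ _ x w y z e f g h) => //=.
  by rewrite !inE !negb_or xw xy xz (eq_sym w) yw wz yz.
(* Reversed so that the first vertex of the second pair avoids the first pair, as [linked_distinct]
   requires. *)
have hzx : linked h z x by rewrite linkedC.
have gzy : linked g z y by rewrite linkedC.
rewrite !inE !negb_or !andbT; apply/and3P; split; first (apply/and3P; split).
- by apply: linked_distinct exw fyw _ _ => //; rewrite eq_sym.
- by apply: linked_distinct exw gyz _ _ => //; rewrite eq_sym.
- by apply: linked_distinct exw hzx _ _; rewrite eq_sym.
- apply/andP; split; first by apply: linked_distinct fyw gzy _ _; rewrite eq_sym.
  exact: linked_distinct fyw hxz _ _.
- exact: linked_distinct gyz hxz _ _.
Qed.

End Links.

Definition link_graphs n r (H : hypergraph n) :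
    {ffun 'I_r * 'I_r -> {ffun 'I_n -> {set 'I_n}}} :=
  [ffun p : 'I_r * 'I_r => link_graph p.1 p.2 H].

(** Two vertices of a hyperedge of [H] are adjacent in the link graph of their ranks, hence share a
    hyperedge of [H']; so each hyperedge of [H] is an [r]-clique in the shadow of [H']. *)
Lemma link_graphs_sub n r (H H' : hypergraph n) : 2 <= r ->
  uniform r H -> uniform r H' -> girth_ge5 H' ->
  link_graphs r H = link_graphs r H' -> H \subset H'.
Proof.
move=> r2 /forall_inP unifH unifH' girthH' eq_links.
apply/subsetP => e eH; have /eqP carde := unifH e eH.
apply: (shadow_clique r2 unifH' girthH' carde) => x y xe ye xy.
have rank_lt z : z \in e -> rank_in e z < r.
  by move=> ze; rewrite -carde cardE index_mem mem_enum.
move/ffunP/(_ (Ordinal (rank_lt x xe), Ordinal (rank_lt y ye))): eq_links.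
rewrite !ffunE /= => /ffunP/(_ x)/setP/(_ y); rewrite !ffunE !inE xy /=.
have -> : [exists e' in H, linked (rank_in e x) (rank_in e y) e' x y].
  by apply/exists_inP; exists e; rewrite // /linked xe ye !eqxx.
by move/esym/exists_inP => [f fH /and3P[xf yf _]]; exists f; rewrite ?xf.
Qed.

Lemma card_girth_ge5 r : 2 <= r -> exists C, forall n s, s ^ 2 <= n < s.+1 ^ 2 ->
  #|[set H : hypergraph n | uniform r H && girth_ge5 H]| <= 2 ^ (C * (s * n)).
Proof.
move=> r2; have [C HC] := card_C4_free_setT.
exists (C * (r * r)) => n s ns.
have := HC 'I_n s; rewrite card_ord => /(_ ns) boundC4.
rewrite -(@card_in_imset _ _ (@link_graphs n r)); last first.
  move=> H H'; rewrite !inE => /andP[unifH girthH] /andP[unifH' girthH'] eqHH'.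
  by apply/eqP; rewrite eqEsubset !(@link_graphs_sub n r).
have le_graphs : #|[set @link_graphs n r H | H in
      [set H : hypergraph n | uniform r H && girth_ge5 H]]|
    <= #|C4_free_on [set: 'I_n]| ^ (r * r).
  rewrite -[in leqRHS](card_ord r) -card_prod -card_ffun_on.
  apply: subset_leq_card; apply/subsetP => _ /imsetP[H + ->].
  rewrite inE => /andP[_ girthH]; apply/ffun_onP => p; rewrite ffunE inE.
  by rewrite link_graph_C4_free //=; apply/forallP => x; apply: subsetT.
apply: leq_trans le_graphs _; rewrite mulnAC [leqRHS]expnM leq_exp2r //.
by rewrite muln_gt0 (ltnW r2).
Qed.

(* Imported only here: [Reals] turns [^] on [nat] into [Nat.pow]. *)
From Stdlib Require Import Reals Lra.

(** * Passage to real exponents *)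

Lemma INR_expn2 k : INR (expn 2 k) = Rpower 2 (INR k).
Proof.
rewrite Rpower_pow; last by lra.
by elim: k => [|k IHk]; rewrite ?expnS ?mult_INR ?IHk.
Qed.

Theorem theorem1p8 (r : nat) (hr : 2 <= r) :
  exists c : R, forall n : nat,
    (INR #|[set H : hypergraph n | uniform r H && girth_ge5 H]|
      <= Rpower 2 (c * (INR n * sqrt (INR n))))%R.
Proof.
have [C HC] := card_girth_ge5 hr.
exists (INR C) => n.
have [les lts] := PeanoNat.Nat.sqrt_spec n (PeanoNat.Nat.le_0_l n).
set s := PeanoNat.Nat.sqrt n in les lts.
have ns : leq (expn s 2) n && leq n.+1 (expn s.+1 2).
  by rewrite -!mulnn; apply/andP; split; apply/leP.
have /leP/le_INR := HC n s ns; rewrite INR_expn2 => /Rle_trans; apply.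
apply: Rle_Rpower; first by lra.
rewrite !mult_INR; apply: Rmult_le_compat_l; first exact: pos_INR.
rewrite Rmult_comm; apply: Rmult_le_compat_l; first exact: pos_INR.
(* The integer square root is at most the real one, as its square is at most [n]. *)
rewrite -(sqrt_square (INR s)); last exact: pos_INR.
by apply: sqrt_le_1_alt; rewrite -mult_INR; apply: le_INR.
Qed.
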